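(* Let $\nu$ be a generalized semiclassical weight on $\mathbb T$. Then for every $n\in\mathbb N$ the corresponding structure matrices satisfy $$M_{n+1}\Big\{T_n'-\frac1{2z}T_n\Big\}+\Big\{T_n'-\frac1{2z}T_n\Big\}M_n=M_{n+1}^2T_n-T_nM_n^2 .$$
   Context: $\mathbb N=\{1,2,\dots\}$, $\mathbb T=\{|z|=1\}$ (counterclockwise). $\nu$ is a positive integrable weight on $\mathbb T$ and $d\mu(z)=\frac{\nu(z)}{\mathrm i z}dz$. $\Phi_n$ is the monic polynomial of degree $n$ with $\int_{\mathbb T}\Phi_n\overline{\Phi_m}\,d\mu=\kappa_n^{-2}\delta_{n,m}$, $\kappa_n>0$; $\Phi_n^*(z)=z^n\overline{\Phi_n(1/\bar z)}$; $\alpha_{n-1}=-\overline{\Phi_n(0)}$ ($n\ge1$); $b_n=2\pi\kappa_n^2$. For $z\notin\mathbb T$, $$G_n(z)=\frac1{2\pi \mathrm i}\int_{\mathbb T}\frac{\Phi_n(t)}{t-z}\frac{\nu(t)}{t^n}dt,\quad G_{n-1}^*(z)=\frac1{2\pi \mathrm i}\int_{\mathbb T}\frac{\Phi_{n-1}^*(t)}{t-z}\frac{\nu(t)}{t^n}dt,\quad Y_n=\begin{bmatrix}\Phi_n&G_n\\-b_{n-1}\Phi_{n-1}^*&-b_{n-1}G_{n-1}^*\end{bmatrix}\quad(n\in\mathbb N),$$ and the transfer matrix is $$T_n(z)=\begin{bmatrix}z+\overline{\alpha}_n\alpha_{n-1}&\overline{\alpha}_n/b_n\\ \alpha_{n-1}b_n&1\end{bmatrix}.$$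 Generalized semiclassical weight: $\nu$ satisfies $zA(z)\nu'(z)=q(z)\nu(z)$ off the set $\mathcal Z_A$ of zeros of $zA(z)$, where $A$ is a (nonzero) polynomial and $q$ is entire. Off $\mathcal Z_A$, $\nu$ denotes the (possibly multivalued, nonvanishing) analytic function determined by this equation and the weight on $\mathbb T\setminus \mathcal Z_A$. $C_n(z)=\operatorname{diag}\big(z^{-n/2}\nu(z)^{1/2},\,z^{n/2}\nu(z)^{-1/2}\big)$, $Z_n=Y_nC_n$, $M_n=Z_n'Z_n^{-1}$ (structure matrix). Local analytic branches are used for the powers; $C_n'C_n^{-1}=\big(-\frac n{2z}+\frac{q(z)}{2zA(z)}\big)\operatorname{diag}(1,-1)$ and $M_n$ do not depend on the branches and are single valued on $\mathbb C\setminus(\mathbb T\cup\mathcal Z_A)$, where the formula is understood to hold. *)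

(* Defs.v *)
From HB Require Import structures.
From mathcomp Require Import all_boot all_order all_algebra complex.
From mathcomp Require Import all_classical all_reals all_analysis.

Set Implicit Arguments.
Unset Strict Implicit.
Unset Printing Implicit Defensive.

Import Order.TTheory GRing.Theory Num.Theory.
Import numFieldNormedType.Exports.

Local Open Scope classical_set_scope.
Local Open Scope ring_scope.

(* R[i] has no topology of its own in the library; seen as a
   [numClosedFieldType] it inherits the normed-space structure, and [derivable]
   and [derive1] over it are complex differentiability and the complex
   derivative. *)
Definition Cx (R : realType) : numClosedFieldType := R[i]%C.

Definition toC (R : realType) (x : R) : Cx R := (x%:C)%C.

Definition unit_circle (R : realType) : set (Cx R) := [set z | `|z| = 1].

Definition expi (R : realType) (theta : R) : Cx R :=
  (cos theta +i* sin theta)%C.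

(* Lebesgue integral of a complex-valued function over [0, 2 pi]. *)
Definition Cintegral (R : realType) (f : R -> Cx R) : Cx R :=
  (Rintegral lebesgue_measure `[0, pi *+ 2] (fun x => complex.Re (f x)) +i*
   Rintegral lebesgue_measure `[0, pi *+ 2] (fun x => complex.Im (f x)))%C.

(* \int_T f(z) dz, T counterclockwise: z = e^{i theta}, dz = i z d theta. *)
Definition circle_integral (R : realType) (f : Cx R -> Cx R) : Cx R :=
  Cintegral (fun theta => f (expi theta) * ('i * expi theta)).

(* Weights live on T; their values elsewhere are never used. *)
Definition is_weight (R : realType) (nu : Cx R -> R) : Prop :=
  lebesgue_measure.-integrable `[0, pi *+ 2]
    (fun theta : R => (nu (expi theta))%:E) /\
  {ae lebesgue_measure, forall theta : R,
     theta \in `[0, pi *+ 2] -> 0 < nu (expi theta)}.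

(* \int_T f d mu, with d mu(z) = nu(z) / (i z) dz. *)
Definition mu_integral (R : realType) (nu : Cx R -> R) (f : Cx R -> Cx R)
    : Cx R :=
  circle_integral (fun z => f z * (toC (nu z) / ('i * z))).

Definition monic_OPUC (R : realType) (nu : Cx R -> R)
    (Phi : nat -> {poly Cx R}) (kappa : nat -> R) : Prop :=
  (forall n, [/\ Phi n \is monic, size (Phi n) = n.+1 & 0 < kappa n]) /\
  (forall n m, mu_integral nu (fun z => (Phi n).[z] * ((Phi m).[z])^* ) =
               toC (kappa n ^- 2) * (n == m)%:R).

(* z^n \overline{p(1 / \bar z)}, as a polynomial so that its value at 0 is the
   right one; see [rev_polyE]. *)
Definition rev_poly (R : realType) (n : nat) (p : {poly Cx R}) : {poly Cx R} :=
  \poly_(k < n.+1) (p`_(n - k))^*.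

Lemma rev_polyE (R : realType) (n : nat) (p : {poly Cx R}) (z : Cx R) :
  (size p <= n.+1)%N -> z != 0 ->
  (rev_poly n p).[z] = z ^+ n * (p.[(z^* )^-1])^*.
Proof.
move=> sp z0; rewrite horner_poly (horner_coef_wide _ sp) rmorph_sum mulr_sumr.
rewrite (reindex_inj rev_ord_inj) /=; apply: eq_bigr => -[k /=].
rewrite ltnS => kn _; rewrite subSS subKn// rmorphM rmorphXn /= fmorphV /= conjCK.
by rewrite exprVn mulrCA -[in RHS](subnK kn) exprD mulfK ?expf_neq0.
Qed.

(* alpha Phi n is \alpha_n; thus \alpha_{n-1} = alpha Phi n.-1 for n >= 1. *)
Definition alpha (R : realType) (Phi : nat -> {poly Cx R}) (n : nat) : Cx R :=
  - ((Phi n.+1).[0])^*.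

Definition coef_b (R : realType) (kappa : nat -> R) (n : nat) : Cx R :=
  toC (pi *+ 2 * kappa n ^+ 2).

Definition mx2 (K : Type) (a b c d : K) : 'M[K]_2 :=
  \matrix_(i < 2, j < 2)
    if i == ord0 then (if j == ord0 then a else b)
    else (if j == ord0 then c else d).

Definition mx_derive (R : realType) (F : Cx R -> 'M[Cx R]_2) (z : Cx R)
    : 'M[Cx R]_2 :=
  \matrix_(i, j) derive1 (fun w => F w i j) z.

Definition G (R : realType) (nu : Cx R -> R) (Phi : nat -> {poly Cx R})
    (n : nat) (z : Cx R) : Cx R :=
  (2 * toC pi * 'i)^-1 *
  circle_integral (fun t => (Phi n).[t] / (t - z) * (toC (nu t) / t ^+ n)).

(* G_m^*; the power of t in the integrand is m + 1. *)
Definition Gstar (R : realType) (nu : Cx R -> R) (Phi : nat -> {poly Cx R})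
    (m : nat) (z : Cx R) : Cx R :=
  (2 * toC pi * 'i)^-1 *
  circle_integral
    (fun t => (rev_poly m (Phi m)).[t] / (t - z) * (toC (nu t) / t ^+ m.+1)).

(* Y_n and T_n are meant for n >= 1. *)
Definition Ymx (R : realType) (nu : Cx R -> R) (Phi : nat -> {poly Cx R})
    (kappa : nat -> R) (n : nat) (z : Cx R) : 'M[Cx R]_2 :=
  mx2 (Phi n).[z] (G nu Phi n z)
      (- coef_b kappa n.-1 * (rev_poly n.-1 (Phi n.-1)).[z])
      (- coef_b kappa n.-1 * Gstar nu Phi n.-1 z).

Definition transfer_mx (R : realType) (Phi : nat -> {poly Cx R})
    (kappa : nat -> R) (n : nat) (z : Cx R) : 'M[Cx R]_2 :=
  mx2 (z + (alpha Phi n)^* * alpha Phi n.-1)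
      ((alpha Phi n)^* / coef_b kappa n)
      (alpha Phi n.-1 * coef_b kappa n)
      1.

(* Zeros of z A(z). *)
Definition Z_ (R : realType) (A : {poly Cx R}) : set (Cx R) :=
  [set z | z * A.[z] = 0].

(* l is the derivative nu'(z) along the circle. *)
Definition circle_derive (R : realType) (nu : Cx R -> R) (z l : Cx R) : Prop :=
  toC (nu t - nu z) / (t - z) @[t --> within (@unit_circle R) z^'] --> l.

Definition generalized_semiclassical (R : realType) (nu : Cx R -> R)
    (A : {poly Cx R}) (q : Cx R -> Cx R) : Prop :=
  [/\ is_weight nu, A != 0, (forall z, derivable q z 1) &
      forall z, unit_circle z -> ~ Z_ A z ->
        exists2 l, circle_derive nu z l & z * A.[z] * l = q z * toC (nu z)].

(* f is, near z, a branch of the multivalued function nu: it is obtained by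
   analytic continuation of the weight along a path gamma in the complement of
   Z_A from a point of T to z, F t being the function element at gamma t. *)
Definition nu_branch (R : realType) (nu : Cx R -> R) (A : {poly Cx R})
    (q : Cx R -> Cx R) (z : Cx R) (f : Cx R -> Cx R) : Prop :=
  exists (gamma : R -> Cx R) (F : R -> Cx R -> Cx R),
  [/\ [/\ {within `[0, 1], continuous gamma},
          (forall t : R, t \in `[0, 1] -> ~ Z_ A (gamma t)),
          unit_circle (gamma 0) & gamma 1 = z],
      (forall t : R, t \in `[0, 1] -> \forall w \near gamma t,
         [/\ derivable (F t) w 1, F t w != 0 &
             w * A.[w] * derive1 (F t) w = q w * F t w]),
      (forall s : R, s \in `[0, 1] -> \forall t \near s, t \in `[0, 1] ->
         \forall w \near gamma t, F s w = F t w),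
      (\forall w \near gamma 0, unit_circle w -> F 0 w = toC (nu w)) &
      (\forall w \near z, f w = F 1 w)].

Definition sqrt_branch (R : realType) (f : Cx R -> Cx R) (z : Cx R)
    (g : Cx R -> Cx R) : Prop :=
  \forall w \near z, derivable g w 1 /\ g w ^+ 2 = f w.

(* C_n, with s and h local branches of z^{1/2} and nu^{1/2}. *)
Definition Cmx (R : realType) (s h : Cx R -> Cx R) (n : nat) (z : Cx R)
    : 'M[Cx R]_2 :=
  mx2 (s z ^- n * h z) 0 0 (s z ^+ n * (h z)^-1).

Definition Zmx (R : realType) (nu : Cx R -> R) (Phi : nat -> {poly Cx R})
    (kappa : nat -> R) (s h : Cx R -> Cx R) (n : nat) (z : Cx R)
    : 'M[Cx R]_2 :=
  Ymx nu Phi kappa n z *m Cmx s h n z.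

(* M is the value at z of the structure matrix M_n = Z_n' Z_n^{-1}, computed
   with some local branches at z. *)
Definition is_structure_mx (R : realType) (nu : Cx R -> R) (A : {poly Cx R})
    (q : Cx R -> Cx R) (Phi : nat -> {poly Cx R}) (kappa : nat -> R)
    (n : nat) (z : Cx R) (M : 'M[Cx R]_2) : Prop :=
  exists s f h : Cx R -> Cx R,
  [/\ sqrt_branch id z s, nu_branch nu A q z f, sqrt_branch f z h &
      M = mx_derive (Zmx nu Phi kappa s h n) z *m
          invmx (Zmx nu Phi kappa s h n z)].

(* Main.v *)
Require Import Defs.
From HB Require Import structures.
From mathcomp Require Import all_boot all_order all_algebra complex.
From mathcomp Require Import all_classical all_reals all_analysis.
From mathcomp Require Import measurable_realfun.
From mathcomp Require Import ring.

Set Implicit Arguments.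
Unset Strict Implicit.
Unset Printing Implicit Defensive.

Import Order.TTheory GRing.Theory Num.Theory.
Import numFieldNormedType.Exports.
Local Open Scope classical_set_scope.
Local Open Scope ring_scope.

(* Szego's recursions for Phi_n and Phi_n^* and the orthogonality relations
   give Y_{n+1} = T_n Y_n diag(1, 1/z), that is Z_{n+1} = z^{-1/2} T_n Z_n.
   Taking logarithmic derivatives, with det Y_n = 1 ensuring invertibility,
   T_n' - T_n / (2z) = M_{n+1} T_n - T_n M_n, and multiplying this by M_{n+1}
   on the left and by M_n on the right and adding gives the identity. *)

(** * Integration against the weight *)

(** [Mn] and [Mn1] may be computed with different branches of the square roots and of nu, so Z_{n+1}
    = z^{-1/2} T_n Z_n cannot be used literally. Instead C_n is cancelled, which leaves the
    branch-free relation M_n Y_n = Y_n' + Y_n diag(a_n, -a_n), where a_n is the logarithmic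
    derivative of z^{-n/2} nu^{1/2}. The factor z^{-1/2} survives only as the scalar -1/(2z),
    produced by a_{n+1} - a_n together with the derivative of diag(1, 1/z). On the analytic side nu
    is merely integrable. Every integrand is therefore kept in the form of a function continuous on
    the circle times nu; linearity, bounds and the derivative of the Cauchy integrals all rest on
    this form. *)

(* The integral of f nu over T with respect to the angle. *)
Definition wint (R : realType) (nu : Cx R -> R) (f : Cx R -> Cx R) : Cx R :=
  Cintegral (fun theta => f (expi theta) * toC (nu (expi theta))).

(** Continuity is asked of the real and imaginary parts in the angle because [Cintegral] is a pair
    of real Lebesgue integrals. *)
Definition circle_continuous (R : realType) (f : Cx R -> Cx R) : Prop :=
  continuous (fun theta : R => complex.Re (f (expi theta))) /\
  continuous (fun theta : R => complex.Im (f (expi theta))).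

Lemma Re_mulC (R : realType) (x y : Cx R) :
  complex.Re (x * y) = complex.Re x * complex.Re y - complex.Im x * complex.Im y.
Proof. by case: x => a b; case: y. Qed.

Lemma Im_mulC (R : realType) (x y : Cx R) :
  complex.Im (x * y) = complex.Re x * complex.Im y + complex.Im x * complex.Re y.
Proof. by case: x => a b; case: y. Qed.

Lemma norm_expi (R : realType) (theta : R) : `|expi theta| = 1.
Proof. by rewrite normc_def /= cos2Dsin2 sqrtr1. Qed.

Lemma unit_circle_neq0 (R : realType) (t : Cx R) : unit_circle t -> t != 0.
Proof. by rewrite /unit_circle /= -normr_gt0 => ->. Qed.

Lemma conj_unit_circle (R : realType) (t : Cx R) : unit_circle t -> t^* = t^-1.
Proof. by move=> t1; rewrite [RHS]invC_norm t1 expr1n invr1 mul1r. Qed.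

Lemma circle_continuous_eq (R : realType) (f g : Cx R -> Cx R) :
  (forall t, unit_circle t -> f t = g t) ->
  circle_continuous f -> circle_continuous g.
Proof.
move=> fg [fr fi].
have e x : f (expi x) = g (expi x) by apply/fg/norm_expi.
by split => [|]; [have := fr|have := fi]; under eq_fun do rewrite e.
Qed.

Lemma circle_continuousD (R : realType) (f g : Cx R -> Cx R) :
  circle_continuous f -> circle_continuous g ->
  circle_continuous (fun t => f t + g t).
Proof.
move=> [fr fi] [gr gi]; split => x.
- by under eq_fun do rewrite raddfD /=; exact: (cvgD (fr x) (gr x)).
- by under eq_fun do rewrite raddfD /=; exact: (cvgD (fi x) (gi x)).
Qed.

Lemma circle_continuousM (R : realType) (f g : Cx R -> Cx R) :
  circle_continuous f -> circle_continuous g ->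
  circle_continuous (fun t => f t * g t).
Proof.
move=> [fr fi] [gr gi]; split => x.
- under eq_fun do rewrite Re_mulC.
  exact: (cvgB (cvgM (fr x) (gr x)) (cvgM (fi x) (gi x))).
- under eq_fun do rewrite Im_mulC.
  exact: (cvgD (cvgM (fr x) (gi x)) (cvgM (fi x) (gr x))).
Qed.

Lemma circle_continuous_cst (R : realType) (c : Cx R) :
  circle_continuous (fun=> c).
Proof. by split => x; exact: cst_continuous. Qed.

Lemma circle_continuous_id (R : realType) : circle_continuous (@id (Cx R)).
Proof. by split => x; [exact: continuous_cos|exact: continuous_sin]. Qed.

Lemma circle_continuousV (R : realType) (f : Cx R -> Cx R) :
  (forall t, unit_circle t -> f t != 0) ->
  circle_continuous f -> circle_continuous (fun t => (f t)^-1).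
Proof.
move=> f0 [fr fi].
have n0 x : complex.Re (f (expi x)) ^+ 2 + complex.Im (f (expi x)) ^+ 2 != 0.
  apply/eqP => e; have /eqP := add_Re2_Im2 (f (expi x)).
  rewrite e eq_sym expf_eq0 /= normr_eq0; apply/negP/f0; exact: norm_expi.
have nc : continuous (fun x : R => 
   (complex.Re (f (expi x)) ^+ 2 + complex.Im (f (expi x)) ^+ 2)^-1).
  move=> x; apply: cvgV; first exact: n0.
  exact: (cvgD (cvgM (fr x) (fr x)) (cvgM (fi x) (fi x))).
split => x.
- rewrite (_ : (fun _ => _) = fun x => complex.Re (f (expi x)) *
    (complex.Re (f (expi x)) ^+ 2 + complex.Im (f (expi x)) ^+ 2)^-1).
    exact: (cvgM (fr x) (nc x)).
  by apply/funext => y; case: (f (expi y)).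
- rewrite (_ : (fun _ => _) = fun x => - (complex.Im (f (expi x)) *
    (complex.Re (f (expi x)) ^+ 2 + complex.Im (f (expi x)) ^+ 2)^-1)).
    exact: (cvgN (cvgM (fi x) (nc x))).
  by apply/funext => y; case: (f (expi y)).
Qed.

Lemma circle_continuousJ (R : realType) (f : Cx R -> Cx R) :
  circle_continuous f -> circle_continuous (fun t => (f t)^*).
Proof.
move=> [fr fi]; split => x.
- by rewrite (_ : (fun _ => _) = fun x => complex.Re (f (expi x)));
    [exact: fr|apply/funext => y; case: (f (expi y))].
- by rewrite (_ : (fun _ => _) = fun x => - complex.Im (f (expi x)));
    [exact: (cvgN (fi x))|apply/funext => y; case: (f (expi y))].
Qed.

Lemma circle_continuousX (R : realType) (f : Cx R -> Cx R) (n : nat) :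
  circle_continuous f -> circle_continuous (fun t => f t ^+ n).
Proof.
move=> fc; elim: n => [|n ih].
  by under eq_fun do rewrite expr0; exact: circle_continuous_cst.
by under eq_fun do rewrite exprS; exact: circle_continuousM.
Qed.

Lemma circle_continuous_poly (R : realType) (p : {poly Cx R}) :
  circle_continuous (horner p).
Proof.
elim/poly_ind: p => [|p c ih].
  by apply: (circle_continuous_eq _ (circle_continuous_cst 0)) => t _;
    rewrite horner0.
apply: (@circle_continuous_eq _ (fun t => p.[t] * t + c)) => [t _|].
  by rewrite hornerMXaddC.
apply: circle_continuousD; last exact: circle_continuous_cst.
by apply: circle_continuousM => //; exact: circle_continuous_id.
Qed.

Lemma continuous_segment_bounded (R : realType) (g : R -> R) (a b : R) :
  continuous g -> exists M, forall x, x \in `[a, b] -> `|g x| <= M.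
Proof.
move=> gc.
have /compact_bounded [M [Mr HM]] : compact (g @` `[a, b]).
  by apply: continuous_compact;
    [exact: continuous_subspaceT|exact: segment_compact].
exists (M + 1) => x xI; apply: (HM (M + 1)); first by rewrite ltrDl.
by exists x.
Qed.

(** The continuous factor is measurable, and bounded on the compact segment; a bounded measurable
    multiple of an integrable function is integrable. *)
Lemma integrable_continuous_weight (R : realType) (nu : Cx R -> R) (g : R -> R) :
  is_weight nu -> continuous g ->
  lebesgue_measure.-integrable `[0, pi *+ 2]
    (EFin \o (fun theta : R => g theta * nu (expi theta))).
Proof.
move=> [nui _] gc.
rewrite (_ : EFin \o _ =
  ((EFin \o g) \* (fun theta : R => (nu (expi theta))%:E))%E); last first.
  by apply/funext => x; rewrite /= EFinM.
apply: integrableMr nui => //.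
  by apply: measurable_funTS; exact: continuous_measurable_fun.
have [M HM] := continuous_segment_bounded 0 (pi *+ 2) gc.
exists M; split=> [|K MK x xI]; first exact: num_real.
by rewrite /= (le_trans (HM x xI)) ?ltW.
Qed.

Lemma integrable_EFinZl (R : realType) (D : set R) (c : R) (f : R -> R) :
  measurable D -> lebesgue_measure.-integrable D (EFin \o f) ->
  lebesgue_measure.-integrable D (EFin \o (fun x => c * f x)).
Proof.
move=> mD fi; rewrite (_ : _ \o _ = fun x => (c%:E * (EFin \o f) x)%E).
  exact: integrableZl.
by apply/funext => x; rewrite /= EFinM.
Qed.

(** The weight is real, so multiplying by it acts on each component separately. *)
Lemma wintE (R : realType) (nu : Cx R -> R) (f : Cx R -> Cx R) :
  wint nu f =
  (Rintegral lebesgue_measure `[0, pi *+ 2]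
     (fun x => complex.Re (f (expi x)) * nu (expi x)) +i*
   Rintegral lebesgue_measure `[0, pi *+ 2]
     (fun x => complex.Im (f (expi x)) * nu (expi x)))%C.
Proof.
rewrite /wint /Cintegral.
by congr (_ +i* _)%C; apply: eq_Rintegral => x _;
  case: (f _) => a b; rewrite /= !(mulr0, subr0, add0r).
Qed.

Lemma wintD (R : realType) (nu : Cx R -> R) (f g : Cx R -> Cx R) :
  is_weight nu -> circle_continuous f -> circle_continuous g ->
  wint nu (fun t => f t + g t) = wint nu f + wint nu g.
Proof.
move=> nuw [fr fi] [gr gi]; rewrite !wintE.
apply/eqP; rewrite eq_complex /= -!RintegralD//; last first.
- exact: integrable_continuous_weight.
- exact: integrable_continuous_weight.
- exact: integrable_continuous_weight.
- exact: integrable_continuous_weight.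
by apply/andP; split; apply/eqP; apply: eq_Rintegral => x _;
  case: (f _) => ? ?; case: (g _) => ? ?; rewrite /= mulrDl.
Qed.

Lemma wintZ (R : realType) (nu : Cx R -> R) (c : Cx R) (f : Cx R -> Cx R) :
  is_weight nu -> circle_continuous f ->
  wint nu (fun t => c * f t) = c * wint nu f.
Proof.
move=> nuw [fr fi]; rewrite !wintE.
have ri := integrable_continuous_weight nuw fr.
have ii := integrable_continuous_weight nuw fi.
apply/eqP; rewrite eq_complex Re_mulC Im_mulC /= -!RintegralZl//.
rewrite -RintegralB// -?RintegralD//; last 4 first.
- exact: integrable_EFinZl.
- exact: integrable_EFinZl.
- exact: integrable_EFinZl.
- exact: integrable_EFinZl.
by apply/andP; split; apply/eqP; apply: eq_Rintegral => x _;
  rewrite ?Re_mulC ?Im_mulC; ring.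
Qed.

Lemma eq_wint (R : realType) (nu : Cx R -> R) (f g : Cx R -> Cx R) :
  (forall t, unit_circle t -> f t = g t) -> wint nu f = wint nu g.
Proof.
by move=> fg; rewrite !wintE; congr (_ +i* _)%C; apply: eq_Rintegral => x _;
  rewrite fg//; apply: norm_expi.
Qed.

Lemma wintJ (R : realType) (nu : Cx R -> R) (f : Cx R -> Cx R) :
  is_weight nu -> circle_continuous f ->
  wint nu (fun t => (f t)^*) = (wint nu f)^*.
Proof.
move=> nuw [fr fi]; rewrite !wintE.
have ii := integrable_continuous_weight nuw fi.
apply/eqP; rewrite eq_complex /=; apply/andP; split; apply/eqP.
  by apply: eq_Rintegral => x _; case: (f _).
rewrite -[RHS]mulN1r -RintegralZl//.
by apply: eq_Rintegral => x _; case: (f _) => a b /=; rewrite mulN1r mulNr.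
Qed.

(** * Bounds for weighted integrals and differentiation of Cauchy integrals *)

Lemma normc_le_ReIm (R : realType) (x : Cx R) :
  `|x| <= toC (`|complex.Re x| + `|complex.Im x|).
Proof.
rewrite {1}[x]complexE (le_trans (ler_normD _ _))// normrM complexiE normCi mul1r.
by rewrite !normc_def /= expr0n /= !addr0 !sqrtr_sqr -rmorphD lecR.
Qed.

Lemma normc_ge_Im (R : realType) (x : Cx R) : toC `|complex.Im x| <= `|x|.
Proof.
rewrite -(normrN (complex.Im _)) -ReiNIm (le_trans (normc_ge_Re _))//.
by rewrite normrM complexiE normCi mulr1.
Qed.

Lemma circle_continuous_bounded (R : realType) (f : Cx R -> Cx R) :
  circle_continuous f -> exists K : R, forall theta : R,
    theta \in `[0, pi *+ 2] -> `|f (expi theta)| <= toC K.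
Proof.
move=> [fr fi].
have [M HM] := continuous_segment_bounded 0 (pi *+ 2) fr.
have [N HN] := continuous_segment_bounded 0 (pi *+ 2) fi.
exists (M + N) => x xI; rewrite (le_trans (normc_le_ReIm _))// lecR.
by rewrite lerD ?HM ?HN.
Qed.

(** [B] is twice the integral of [|nu|], one copy for each of the real and imaginary parts. It does
    not depend on [f], which makes remainder terms in a difference quotient uniformly small. *)
Lemma wint_le (R : realType) (nu : Cx R -> R) :
  is_weight nu -> exists B : R, forall (K : R) (f : Cx R -> Cx R),
    circle_continuous f ->
    (forall theta : R, theta \in `[0, pi *+ 2] -> `|f (expi theta)| <= toC K) ->
    `|wint nu f| <= toC (K * B).
Proof.
move=> nuw; have [nui _] := nuw.
pose I := Rintegral lebesgue_measure `[0, pi *+ 2] (fun x : R => `|nu (expi x)|).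
have nai : lebesgue_measure.-integrable `[0, pi *+ 2]
    (EFin \o (fun x : R => `|nu (expi x)|)) by exact: integrable_norm.
exists (I + I) => K f [fr fi] fK.
have bd (g : R -> R) : continuous g ->
    (forall x, x \in `[0, pi *+ 2] -> `|g x| <= K) ->
    `|Rintegral lebesgue_measure `[0, pi *+ 2] (fun x => g x * nu (expi x))|
      <= K * I.
  move=> gc gK; have gi := integrable_continuous_weight nuw gc.
  rewrite (le_trans (le_normr_Rintegral _ _))// /I -RintegralZl//.
  apply: le_Rintegral => //; [exact: integrable_norm|exact: integrable_EFinZl|].
  by move=> x xI; rewrite normrM ler_wpM2r// gK.
rewrite wintE (le_trans (normc_le_ReIm _))// lecR mulrDr lerD//.
- by apply: bd => // x xI; rewrite -lecR (le_trans (normc_ge_Re _))// fK.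
- by apply: bd => // x xI; rewrite -lecR (le_trans (normc_ge_Im _))// fK.
Qed.

Lemma circle_continuous_Cauchy (R : realType) (g : Cx R -> Cx R) (z : Cx R) :
  ~ unit_circle z -> circle_continuous g ->
  circle_continuous (fun t => g t / (t - z)).
Proof.
move=> zT gc; apply: circle_continuousM => //; apply: circle_continuousV.
  by move=> t t1; rewrite subr_eq0; apply: contra_not_neq zT => <-.
by apply: circle_continuousD; [exact: circle_continuous_id|
  exact: circle_continuous_cst].
Qed.

(** [d] is half the distance from [z] to the circle, so by the triangle inequality the ball of
    radius [d] around [z] stays at distance at least [d] from the circle. *)
Lemma off_circle_dist (R : realType) (z : Cx R) : ~ unit_circle z ->
  exists2 d : R, 0 < d & forall w t, unit_circle t -> `|w - z| < toC d ->
    toC d <= `|t - w|.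
Proof.
move=> zT; have [r hr] : exists r, `|z| = toC r by eexists; exact: normc_def.
have d0 : 0 < `|1 - r|.
  rewrite normr_gt0 subr_eq0; apply: contra_not_neq zT => r1.
  by rewrite /unit_circle /= hr -r1.
exists (`|1 - r| / 2) => [|w t t1 wz]; first by rewrite divr_gt0.
have tz : toC `|1 - r| <= `|t - z|.
  have := ler_dist_dist t z; rewrite t1 hr.
  by rewrite -[1]/(toC 1) -rmorphB normc_def /= expr0n /= addr0 sqrtr_sqr.
have := le_trans tz (ler_distD w t z).
have -> : toC `|1 - r| = toC (`|1 - r| / 2) + toC (`|1 - r| / 2).
  by rewrite -rmorphD -splitr.
move=> H; rewrite -(lerD2r (toC (`|1 - r| / 2))) (le_trans H)//.
by rewrite lerD2l ltW.
Qed.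

Lemma near_off_circle (R : realType) (z : Cx R) : ~ unit_circle z ->
  \forall w \near z, ~ unit_circle w.
Proof.
move=> /off_circle_dist [d d0 hd].
apply/nbhs_ballP; exists (toC d); first by rewrite /= ltcR.
(* A point [w] of the ball lying on the circle would be at distance at least [d] from itself. *)
move=> w /= wz w1; have := hd w w w1; rewrite subrr normr0 distrC => /(_ wz).
by rewrite lecR leNgt d0.
Qed.

(** Differentiation under the integral is done by an explicit remainder: the difference quotient
    minus the candidate is [h] times an integral in which [K] bounds [g / (t - z)^2], [1 / d] bounds
    [1 / (t - w)] and [B] accounts for the weight. *)
Lemma is_derive_Cauchy (R : realType) (nu : Cx R -> R) (g : Cx R -> Cx R)
    (z : Cx R) :
  is_weight nu -> circle_continuous g -> ~ unit_circle z ->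
  is_derive z 1 (fun w => wint nu (fun t => g t / (t - w)))
    (wint nu (fun t => g t / (t - z) / (t - z))).
Proof.
move=> nuw gc zT; set L := wint nu (fun t => g t / (t - z) / (t - z)).
have gzc := circle_continuous_Cauchy zT gc.
have gzzc := circle_continuous_Cauchy zT gzc.
have [K HK] := circle_continuous_bounded gzzc.
have [B HB] := wint_le nuw.
have [d d0 hd] := off_circle_dist zT.
suff: (fun h : Cx R => h^-1 *: (((fun w => wint nu (fun t => g t / (t - w))) \o
     shift z) (h *: 1) - wint nu (fun t => g t / (t - z)))) @ 0^' --> L.
  move=> H; split; last exact: (cvg_lim _ H).
  by apply/cvg_ex; exists L.
have main h : h != 0 -> `|h| < toC d ->
  `|h^-1 *: (wint nu (fun t => g t / (t - (h *: 1 + z))) -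
     wint nu (fun t => g t / (t - z))) - L| <= `|h| * toC (K / d * B).
  move=> h0 hlt; set w := h *: 1 + z.
  have wE : w = h + z by rewrite /w [h *: 1]mulr1.
  have wzd : `|w - z| < toC d by rewrite wE addrK.
  have wT : ~ unit_circle w.
    move=> w1; have := hd w w w1 wzd; rewrite subrr normr0 lecR.
    by rewrite leNgt d0.
  have gwc := circle_continuous_Cauchy wT gc.
  have gzzwc := circle_continuous_Cauchy wT gzzc.
  (* 1/(t-w) = 1/(t-z) + h (1/(t-z)^2 + h / ((t-z)^2 (t-w))) for w = z + h *)
  rewrite [X in X - L](_ : _ = L +
      h * wint nu (fun t => g t / (t - z) / (t - z) / (t - w))).
    rewrite addrC addKr normrM ler_wpM2l// HB// => x xI.
    rewrite normrM normfV /toC rmorphM /= ler_pM ?HK//.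
    rewrite fmorphV /= lef_pV2 ?hd//.
    - exact: norm_expi.
    - by rewrite posrE (lt_le_trans _ (hd _ _ (norm_expi _) wzd)) ?ltcR.
    - by rewrite posrE ltcR.
  have -> : wint nu (fun t => g t / (t - w)) =
    wint nu (fun t => g t / (t - z)) +
    h * (L + h * wint nu (fun t => g t / (t - z) / (t - z) / (t - w))).
    rewrite /L -wintZ// -wintD//; last first.
      by apply: circle_continuousM => //; exact: circle_continuous_cst.
    rewrite -wintZ//; last first.
      apply: circle_continuousD => //.
      by apply: circle_continuousM => //; exact: circle_continuous_cst.
    rewrite -wintD//; last first.
      apply: circle_continuousM; first exact: circle_continuous_cst.
      apply: circle_continuousD => //.
      by apply: circle_continuousM => //; exact: circle_continuous_cst.
    apply: eq_wint => t t1.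
    have tz : t - z != 0 by rewrite subr_eq0; apply: contra_not_neq zT => <-.
    have tw : t - w != 0 by rewrite subr_eq0; apply: contra_not_neq wT => <-.
    by move: tw; rewrite wE => tw; field; rewrite tz tw.
  by rewrite addrC addKr /GRing.scale /= mulKf.
apply/cvgrPdist_le => e e0.
(* [K] and [B] are only known to exist, so the sign of [K / d * B] is not known; the absolute value
   and the later [+ 1] give a positive denominator. *)
pose C := toC `|K / d * B|.
have C0 : 0 <= C by rewrite lecR.
have eC : 0 < e / (C + 1) by rewrite divr_gt0// ltr_wpDl.
near=> h.
have hC : `|h| <= e / (C + 1).
  by near: h; apply: dnbhs0_le.
rewrite distrC (le_trans (main h _ _))//.
- by near: h; exact: nbhs_dnbhs_neq.
- by near: h; apply: dnbhs0_lt; rewrite ltcR.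
- rewrite (@le_trans _ _ (e / (C + 1) * C))//.
    rewrite (@le_trans _ _ (`|h| * C))//; last exact: ler_wpM2r.
    by rewrite ler_wpM2l// lecR ler_norm.
  rewrite mulrAC ler_pdivrMr ?ltr_wpDl// mulrDr mulr1 lerDl; exact: ltW.
Unshelve. all: by end_near.
Qed.

(** * Szego recursions *)

Definition ip (R : realType) (nu : Cx R -> R) (p q : {poly Cx R}) : Cx R :=
  wint nu (fun t => p.[t] * (q.[t])^* ).

(** The [i z] of [dz = i z d theta] cancels the one in the denominator of [d mu]. *)
Lemma mu_integralE (R : realType) (nu : Cx R -> R) (f : Cx R -> Cx R) :
  mu_integral nu f = wint nu f.
Proof.
congr Cintegral; apply/funext => x.
have e0 : expi x != 0 by apply/unit_circle_neq0/norm_expi.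
by field; rewrite e0 neq0Ci.
Qed.

Lemma circle_continuous_ip (R : realType) (p q : {poly Cx R}) :
  circle_continuous (fun t => p.[t] * (q.[t])^* ).
Proof.
apply: circle_continuousM; first exact: circle_continuous_poly.
apply: circle_continuousJ; exact: circle_continuous_poly.
Qed.

Lemma ipDl (R : realType) (nu : Cx R -> R) (p q r : {poly Cx R}) :
  is_weight nu -> ip nu (p + q) r = ip nu p r + ip nu q r.
Proof.
move=> nuw; rewrite /ip -wintD//; [|exact: circle_continuous_ip..].
by apply: eq_wint => t _; rewrite hornerD mulrDl.
Qed.

Lemma ipZl (R : realType) (nu : Cx R -> R) c (p r : {poly Cx R}) :
  is_weight nu -> ip nu (c *: p) r = c * ip nu p r.
Proof.
move=> nuw; rewrite /ip -wintZ//; last exact: circle_continuous_ip.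
by apply: eq_wint => t _; rewrite hornerZ mulrA.
Qed.

Lemma ipBl (R : realType) (nu : Cx R -> R) (p q r : {poly Cx R}) :
  is_weight nu -> ip nu (p - q) r = ip nu p r - ip nu q r.
Proof. by move=> nuw; rewrite -scaleN1r ipDl// ipZl// mulN1r. Qed.

Lemma ip0l (R : realType) (nu : Cx R -> R) (r : {poly Cx R}) :
  is_weight nu -> ip nu 0 r = 0.
Proof. by move=> nuw; rewrite -(scale0r 0) ipZl// mul0r. Qed.

Lemma ipC (R : realType) (nu : Cx R -> R) (p q : {poly Cx R}) :
  is_weight nu -> ip nu q p = (ip nu p q)^*.
Proof.
move=> nuw; rewrite /ip -wintJ//; last exact: circle_continuous_ip.
by apply: eq_wint => t _; rewrite rmorphM /= conjCK mulrC.
Qed.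

(** Multiplication by [t] is an isometry because [t] times its conjugate is 1 on the circle. *)
Lemma ip_mulX (R : realType) (nu : Cx R -> R) (p q : {poly Cx R}) :
  ip nu ('X * p) ('X * q) = ip nu p q.
Proof.
apply: eq_wint => t t1; rewrite !hornerM !hornerX rmorphM /=.
by rewrite (conj_unit_circle t1) mulrACA mulfV ?mul1r// unit_circle_neq0.
Qed.

(** Monic polynomials of every degree span, by removing the leading term of [q] repeatedly. The
    family [B] is left free because it is taken to be both [Phi] and the monomials. *)
Lemma ip_eq0_monic (R : realType) (nu : Cx R -> R) (B : nat -> {poly Cx R})
    (n : nat) (p q : {poly Cx R}) :
  is_weight nu -> (forall k, B k \is monic /\ size (B k) = k.+1) ->
  (forall k, (k < n)%N -> ip nu (B k) p = 0) ->
  (size q <= n)%N -> ip nu q p = 0.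
Proof.
move=> nuw Bm Bp; elim: n q Bp => [|n ih] q Bp sq.
  by move: sq; rewrite leqn0 size_poly_eq0 => /eqP ->; rewrite ip0l.
have [/monicP Bn sB] := Bm n.
rewrite -(subrK (q`_n *: B n) q) ipDl// ipZl// (Bp n)// mulr0 addr0.
apply: ih => [k kn|]; first exact: (Bp k (ltnW kn)).
apply/leq_sizeP => j; rewrite leq_eqVlt coefB coefZ => /predU1P[<-|nj].
  by move: Bn; rewrite lead_coefE sB /= => ->; rewrite mulr1 subrr.
by rewrite (nth_default _ (leq_trans sq nj))
  [(B n)`_j]nth_default ?sB// mulr0 subrr.
Qed.

Lemma ip_OPUC (R : realType) (nu : Cx R -> R) Phi kappa n m :
  monic_OPUC nu Phi kappa ->
  ip nu (Phi n) (Phi m) = toC (kappa n ^- 2) * (n == m)%:R.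
Proof. by case=> _ <-; rewrite mu_integralE. Qed.

Lemma OPUC_monic (R : realType) (nu : Cx R -> R) Phi kappa n :
  monic_OPUC nu Phi kappa -> Phi n \is monic /\ size (Phi n) = n.+1.
Proof. by case=> /(_ n) [? ? _] _. Qed.

Lemma kappaV_neq0 (R : realType) (nu : Cx R -> R) Phi kappa n :
  monic_OPUC nu Phi kappa -> toC (kappa n ^- 2) != 0.
Proof.
case=> /(_ n) [_ _ k0] _; rewrite fmorph_eq0 invr_eq0 expf_eq0 /=.
by rewrite gt_eqF.
Qed.

Lemma OPUC_orth (R : realType) (nu : Cx R -> R) Phi kappa n (p : {poly Cx R}) :
  is_weight nu -> monic_OPUC nu Phi kappa ->
  (size p <= n)%N -> ip nu p (Phi n) = 0.
Proof.
move=> nuw hPhi; apply: (ip_eq0_monic (B := Phi)) => // [k|k kn].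
  exact: (OPUC_monic k hPhi).
by rewrite (ip_OPUC k n hPhi) ltn_eqF// mulr0.
Qed.

Lemma OPUC_orth_Xn (R : realType) (nu : Cx R -> R) Phi kappa n k :
  is_weight nu -> monic_OPUC nu Phi kappa ->
  (k < n)%N -> ip nu (Phi n) 'X^k = 0.
Proof.
by move=> nuw hPhi kn; rewrite ipC// (OPUC_orth nuw hPhi) ?conjC0// size_polyXn.
Qed.

(** Subtracting [p_n Phi_n] lowers the degree below [n], and what remains is orthogonal to
    [Phi n]. *)
Lemma OPUC_lead (R : realType) (nu : Cx R -> R) Phi kappa n (p : {poly Cx R}) :
  is_weight nu -> monic_OPUC nu Phi kappa ->
  (size p <= n.+1)%N -> ip nu p (Phi n) = p`_n * toC (kappa n ^- 2).
Proof.
move=> nuw hPhi sp; have [/monicP Pn sP] := OPUC_monic n hPhi.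
rewrite -{1}(subrK (p`_n *: Phi n) p) ipDl// ipZl// (ip_OPUC _ _ hPhi) eqxx mulr1.
rewrite (OPUC_orth nuw hPhi) ?add0r//.
apply/leq_sizeP => j; rewrite leq_eqVlt coefB coefZ => /predU1P[<-|nj].
  by move: Pn; rewrite lead_coefE sP /= => ->; rewrite mulr1 subrr.
by rewrite (nth_default _ (leq_trans sp nj))
  [(Phi n)`_j]nth_default ?sP// mulr0 subrr.
Qed.

(** Nondegeneracy is read off the norms of the [Phi k]: a nonzero [p] would be orthogonal to the
    [Phi] of its own degree, whereas [OPUC_lead] evaluates that product as its leading coefficient
    times a nonzero norm. *)
Lemma ip_Xn_eq0 (R : realType) (nu : Cx R -> R) Phi kappa n (p : {poly Cx R}) :
  is_weight nu -> monic_OPUC nu Phi kappa -> (size p <= n)%N ->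
  (forall k, (k < n)%N -> ip nu p 'X^k = 0) -> p = 0.
Proof.
move=> nuw hPhi sp pX; apply/eqP/negPn/negP => p0.
have sp1 : (size p).-1.+1 = size p by rewrite prednK// lt0n size_poly_eq0.
have [Pm sP] := OPUC_monic (size p).-1 hPhi.
have : ip nu (Phi (size p).-1) p = 0.
  apply: (ip_eq0_monic (B := fun k => 'X^k) (n := n)) => //.
  - by move=> k; rewrite monicXn size_polyXn.
  - by move=> k kn; rewrite ipC// pX// conjC0.
  - by rewrite sP sp1.
rewrite ipC// (OPUC_lead nuw hPhi) ?sp1// -lead_coefE => /eqP.
rewrite conjC_eq0 mulf_eq0 lead_coef_eq0 (negPf p0) /=.
by rewrite (negPf (kappaV_neq0 _ hPhi)).
Qed.

(** * Reversed polynomials and the recursions for [Phi], its reversal and [kappa] *)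

Lemma rev_poly_circle (R : realType) n (p : {poly Cx R}) t :
  (size p <= n.+1)%N -> unit_circle t ->
  (rev_poly n p).[t] = t ^+ n * (p.[t])^*.
Proof.
move=> sp t1; rewrite rev_polyE// ?unit_circle_neq0//.
by rewrite (conj_unit_circle t1) invrK.
Qed.

Lemma rev_polyD (R : realType) n (p q : {poly Cx R}) :
  rev_poly n (p + q) = rev_poly n p + rev_poly n q.
Proof.
apply/polyP => k; rewrite coefD !coef_poly; case: ifP => _.
  by rewrite coefD rmorphD.
by rewrite addr0.
Qed.

Lemma rev_polyZ (R : realType) n c (p : {poly Cx R}) :
  rev_poly n (c *: p) = c^* *: rev_poly n p.
Proof.
apply/polyP => k; rewrite coefZ !coef_poly; case: ifP => _.
  by rewrite coefZ rmorphM.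
by rewrite mulr0.
Qed.

Lemma rev_polyX (R : realType) n (p : {poly Cx R}) :
  rev_poly n.+1 ('X * p) = rev_poly n p.
Proof.
apply/polyP => k; rewrite !coef_poly ltnS coefXM.
case: ltngtP => [kn|//|->]; last by rewrite subnn conjC0.
by rewrite subSn.
Qed.

(** The two reversals are taken at degrees one apart, hence the factor ['X]: on the circle, t^{n+1}
    times the conjugate of t^n conj(p) is t p. *)
Lemma rev_polyK (R : realType) n (p : {poly Cx R}) :
  (size p <= n.+1)%N -> rev_poly n.+1 (rev_poly n p) = 'X * p.
Proof.
move=> sp; apply/polyP => -[|k]; rewrite coefXM !coef_poly /=.
  by rewrite subn0 ltnn conjC0.
rewrite !ltnS subSS; case: leqP => kn; last first.
  by rewrite nth_default// (leq_trans sp).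
by rewrite leq_subr subKn// conjCK.
Qed.

(** Both integrands equal t^{n-k} conj(Phi_n) on the circle. For 1 <= k <= n the right-hand side
    vanishes, so Phi_n^* is orthogonal to X, ..., X^n. *)
Lemma ip_rev_OPUC (R : realType) (nu : Cx R -> R) Phi kappa n k :
  monic_OPUC nu Phi kappa -> (k <= n)%N ->
  ip nu (rev_poly n (Phi n)) 'X^k = ip nu 'X^(n - k) (Phi n).
Proof.
move=> hPhi kn; apply: eq_wint => t t1.
have [_ sP] := OPUC_monic n hPhi.
rewrite rev_poly_circle ?sP// !hornerXn rmorphXn /= (conj_unit_circle t1).
rewrite mulrAC; congr (_ * _).
have tk0 : t ^+ k != 0 by rewrite expf_neq0// unit_circle_neq0.
by apply: (mulIf tk0); rewrite exprVn divfK// -exprD subnK.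
Qed.

(** The defect [Q] has degree at most n because the monic leading terms cancel, and it vanishes at 0
    by the choice of alpha_n, so [Q] is X [Q1] with [Q1] of degree below n. All three terms of [Q]
    are orthogonal to X, ..., X^n; dividing by X makes [Q1] orthogonal to 1, ..., X^{n-1}, hence
    zero. *)
Lemma Szego_recursion (R : realType) (nu : Cx R -> R) Phi kappa n :
  is_weight nu -> monic_OPUC nu Phi kappa ->
  Phi n.+1 = 'X * Phi n - (alpha Phi n)^* *: rev_poly n (Phi n).
Proof.
move=> nuw hPhi.
have [Pm sP] := OPUC_monic n hPhi; have [P1m sP1] := OPUC_monic n.+1 hPhi.
pose Q := Phi n.+1 - ('X * Phi n - (alpha Phi n)^* *: rev_poly n (Phi n)).
suff : Q = 0 by move/eqP; rewrite subr_eq0 => /eqP.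
pose Q1 := \poly_(k < n) Q`_k.+1.
have PE m : lead_coef (Phi m) = (Phi m)`_m.
  by have [_ s] := OPUC_monic m hPhi; rewrite lead_coefE s.
have QE : Q = 'X * Q1.
  apply/polyP => -[|k]; rewrite coefXM /=.
    rewrite /Q !coefB coefXM coefZ coef_poly /= subn0 -PE (monicP Pm) conjC1.
    by rewrite /alpha rmorphN /= conjCK mulr1 sub0r opprK horner_coef0 subrr.
  rewrite coef_poly; case: ltnP => // nk.
  rewrite /Q !coefB coefXM coefZ coef_poly /= ltnS ltnNge nk /= mulr0 subr0.
  have [->|kn] := eqVneq k n.
    by rewrite -!PE (monicP Pm) (monicP P1m) subrr.
  have nk1 : (n < k)%N by rewrite ltn_neqAle eq_sym kn.
  by rewrite !nth_default ?subrr ?sP ?sP1.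
rewrite QE; suff -> : Q1 = 0 by rewrite mulr0.
apply: (ip_Xn_eq0 nuw hPhi (n := n)) => [|k kn]; first exact: size_poly.
rewrite -ip_mulX -QE -exprS /Q !ipBl// ipZl// (OPUC_orth_Xn nuw hPhi)//.
rewrite (ip_rev_OPUC hPhi)// exprS ip_mulX (OPUC_orth_Xn nuw hPhi)//.
rewrite (OPUC_orth nuw hPhi) ?mulr0 ?subrr// size_polyXn.
by rewrite ltn_subrL (leq_trans _ kn).
Qed.

(** Reversal at degree n+1 turns the recursion into Phi_n^* - alpha_n X Phi_n; X Phi_n is then
    eliminated by the recursion itself, since the second row of the transfer matrix needs
    Phi_{n+1}. *)
Lemma Szego_recursion_rev (R : realType) (nu : Cx R -> R) Phi kappa n :
  is_weight nu -> monic_OPUC nu Phi kappa ->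
  rev_poly n.+1 (Phi n.+1) =
  (1 - (alpha Phi n)^* * alpha Phi n) *: rev_poly n (Phi n) -
  alpha Phi n *: Phi n.+1.
Proof.
move=> nuw hPhi; have [_ sP] := OPUC_monic n hPhi.
have SR := Szego_recursion n nuw hPhi.
rewrite {1}SR -scaleNr rev_polyD rev_polyZ rev_polyX rev_polyK ?sP//.
rewrite (_ : 'X * Phi n = Phi n.+1 + (alpha Phi n)^* *: rev_poly n (Phi n)).
  rewrite rmorphN /= conjCK; apply/polyP => k.
  by rewrite !(coefD, coefN, coefZ); ring.
by rewrite SR subrK.
Qed.

(** The reversed recursion is paired with the constant 1: Phi_m^* paired with 1 is X^m paired with
    Phi_m, that is kappa_m^{-2}, and Phi_{n+1} is orthogonal to 1. *)
Lemma kappa_recursion (R : realType) (nu : Cx R -> R) Phi kappa n :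
  is_weight nu -> monic_OPUC nu Phi kappa ->
  toC (kappa n.+1 ^- 2) =
  (1 - (alpha Phi n)^* * alpha Phi n) * toC (kappa n ^- 2).
Proof.
move=> nuw hPhi.
have H m : ip nu (rev_poly m (Phi m)) 'X^0 = toC (kappa m ^- 2).
  rewrite (ip_rev_OPUC hPhi)// subn0 (OPUC_lead nuw hPhi) ?size_polyXn//.
  by rewrite coefXn eqxx mul1r.
rewrite -!H (Szego_recursion_rev _ nuw hPhi) ipBl// !ipZl//.
by rewrite (OPUC_orth_Xn nuw hPhi)// mulr0 subr0.
Qed.

Lemma coef_bE (R : realType) (kappa : nat -> R) n :
  coef_b kappa n = toC (pi *+ 2) / toC (kappa n ^- 2).
Proof. by rewrite /coef_b /toC rmorphM fmorphV /= invrK. Qed.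

Lemma coef_b_neq0 (R : realType) (nu : Cx R -> R) Phi (kappa : nat -> R) n :
  monic_OPUC nu Phi kappa -> coef_b kappa n != 0.
Proof.
move=> hPhi; rewrite coef_bE mulf_neq0 ?invr_eq0 ?(kappaV_neq0 n hPhi)//.
by rewrite fmorph_eq0 mulrn_eq0 /= gt_eqF// pi_gt0.
Qed.

Lemma coef_b_recursion (R : realType) (nu : Cx R -> R) Phi kappa n :
  is_weight nu -> monic_OPUC nu Phi kappa ->
  coef_b kappa n = (1 - (alpha Phi n)^* * alpha Phi n) * coef_b kappa n.+1.
Proof.
move=> nuw hPhi; rewrite !coef_bE (kappa_recursion n nuw hPhi).
(* A nonzero kappa_{n+1}^{-2} forces 1 - |alpha_n|^2 to be nonzero, which licenses the division. *)
have := kappaV_neq0 n.+1 hPhi; rewrite (kappa_recursion n nuw hPhi).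
rewrite mulf_eq0 negb_or => /andP[]; move: (toC _) (toC _) => x y a0 y0.
by field; rewrite y0 a0.
Qed.

(** First row of T_{n+1} against the first column of Y_{n+1}, whose lower entry is -b_n Phi_n^*. The
    quotient b_n / b_{n+1} is the factor 1 - |alpha_n|^2 of the reversed recursion. *)
Lemma OPUC_transfer (R : realType) (nu : Cx R -> R) Phi kappa n :
  is_weight nu -> monic_OPUC nu Phi kappa ->
  Phi n.+2 = 'X * Phi n.+1 + ((alpha Phi n.+1)^* * alpha Phi n) *: Phi n.+1 -
   ((alpha Phi n.+1)^* / coef_b kappa n.+1 * coef_b kappa n) *:
     rev_poly n (Phi n).
Proof.
move=> nuw hPhi; have b0 := coef_b_neq0 n.+1 hPhi.
rewrite (Szego_recursion n.+1 nuw hPhi) (Szego_recursion_rev n nuw hPhi).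
rewrite (coef_b_recursion n nuw hPhi) mulrCA divfK//.
by apply/polyP => k; rewrite !(coefD, coefN, coefZ); ring.
Qed.

(** Second row of T_{n+1} against the same column, with the sign changed. *)
Lemma rev_OPUC_transfer (R : realType) (nu : Cx R -> R) Phi kappa n :
  is_weight nu -> monic_OPUC nu Phi kappa ->
  coef_b kappa n.+1 *: rev_poly n.+1 (Phi n.+1) =
  coef_b kappa n *: rev_poly n (Phi n) -
  (alpha Phi n * coef_b kappa n.+1) *: Phi n.+1.
Proof.
move=> nuw hPhi.
rewrite (Szego_recursion_rev n nuw hPhi) (coef_b_recursion n nuw hPhi).
by apply/polyP => k; rewrite !(coefD, coefN, coefZ); ring.
Qed.

(** * Transfer relation for Y_n *)

(* 2 pi times the Cauchy transform of p(t) nu(t) t^{-n}, written as an integral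
   in the angle (dt = i t d theta). *)
Definition cauchy_transform (R : realType) (nu : Cx R -> R) (n : nat)
    (p : {poly Cx R}) (z : Cx R) : Cx R :=
  wint nu (fun t => p.[t] * (t / t ^+ n) / (t - z)).

Lemma circle_continuous_cauchy_density (R : realType) (n : nat)
    (p : {poly Cx R}) : circle_continuous (fun t => p.[t] * (t / t ^+ n)).
Proof.
apply: circle_continuousM; first exact: circle_continuous_poly.
apply: circle_continuousM; first exact: circle_continuous_id.
apply: circle_continuousV => [t t1|]; first by rewrite expf_neq0// unit_circle_neq0.
by apply: circle_continuousX; exact: circle_continuous_id.
Qed.

Lemma circle_continuous_cauchy (R : realType) (n : nat) (p : {poly Cx R}) z :
  ~ unit_circle z -> circle_continuous (fun t => p.[t] * (t / t ^+ n) / (t - z)).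
Proof.
move=> zT; apply: circle_continuous_Cauchy => //.
exact: circle_continuous_cauchy_density.
Qed.

Lemma subr_off_circle_neq0 (R : realType) (t z : Cx R) :
  unit_circle t -> ~ unit_circle z -> t - z != 0.
Proof. by move=> t1 zT; rewrite subr_eq0; apply: contra_not_neq zT => <-. Qed.

Lemma circle_integral_cauchy (R : realType) (nu : Cx R -> R) n (p : {poly Cx R}) z :
  is_weight nu -> ~ unit_circle z ->
  (2 * toC pi * 'i)^-1 *
    circle_integral (fun t => p.[t] / (t - z) * (toC (nu t) / t ^+ n)) =
  (2 * toC pi)^-1 * cauchy_transform nu n p z.
Proof.
move=> nuw zT; have cc := circle_continuous_cauchy n p zT.
rewrite (_ : circle_integral _ = 'i * cauchy_transform nu n p z).
  by rewrite invfM -mulrA mulKf// neq0Ci.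
rewrite /cauchy_transform -wintZ//; congr Cintegral; apply/funext => x.
have tz := subr_off_circle_neq0 (norm_expi x) zT.
have t0 : expi x ^+ n != 0 by rewrite expf_neq0//
  unit_circle_neq0//; exact: norm_expi.
by move: (expi x ^+ n) t0 => y y0; field; rewrite y0 tz.
Qed.

Lemma cauchyD (R : realType) (nu : Cx R -> R) n (p q : {poly Cx R}) z :
  is_weight nu -> ~ unit_circle z ->
  cauchy_transform nu n (p + q) z =
  cauchy_transform nu n p z + cauchy_transform nu n q z.
Proof.
move=> nuw zT; rewrite /cauchy_transform -wintD//;
  [|exact: circle_continuous_cauchy..].
by apply: eq_wint => t _; rewrite hornerD !mulrDl.
Qed.

Lemma cauchyZ (R : realType) (nu : Cx R -> R) n c (p : {poly Cx R}) z :
  is_weight nu -> ~ unit_circle z -> cauchy_transform nu n (c *: p) z =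
  c * cauchy_transform nu n p z.
Proof.
move=> nuw zT; rewrite /cauchy_transform -wintZ//;
  last exact: circle_continuous_cauchy.
by apply: eq_wint => t _; rewrite hornerZ !mulrA.
Qed.

Lemma cauchyB (R : realType) (nu : Cx R -> R) n (p q : {poly Cx R}) z :
  is_weight nu -> ~ unit_circle z ->
  cauchy_transform nu n (p - q) z =
  cauchy_transform nu n p z - cauchy_transform nu n q z.
Proof. by move=> nuw zT; rewrite -scaleN1r cauchyD// cauchyZ// mulN1r. Qed.

(** t / (t - z) = 1 + z / (t - z), and the term 1 leaves p(t) t^{-n}, where t^{-n} is the conjugate
    of t^n on the circle. *)
Lemma cauchyMX (R : realType) (nu : Cx R -> R) n (p : {poly Cx R}) z :
  is_weight nu -> ~ unit_circle z ->
  cauchy_transform nu n.+1 ('X * p) z =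
  z * cauchy_transform nu n.+1 p z + ip nu p 'X^n.
Proof.
move=> nuw zT; have cc := circle_continuous_cauchy n.+1 p zT.
rewrite /cauchy_transform -wintZ// /ip -wintD//; first last.
- exact: circle_continuous_ip.
- by apply: circle_continuousM => //; exact: circle_continuous_cst.
apply: eq_wint => t t1; have tz := subr_off_circle_neq0 t1 zT.
have t0 := unit_circle_neq0 t1.
rewrite hornerM hornerX hornerXn rmorphXn /= (conj_unit_circle t1) exprS exprVn.
have tn0 : t ^+ n != 0 by rewrite expf_neq0.
by move: (t ^+ n) tn0 => y y0; field; rewrite y0 tz t0.
Qed.

(** Multiplying by ['X] undoes one more division by [t], so this is [cauchyMX] read backwards. *)
Lemma cauchy_succ (R : realType) (nu : Cx R -> R) n (p : {poly Cx R}) z :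
  is_weight nu -> ~ unit_circle z ->
  z * cauchy_transform nu n.+1 p z = cauchy_transform nu n p z - ip nu p 'X^n.
Proof.
move=> nuw zT; apply/eqP; rewrite eq_sym subr_eq -cauchyMX//; apply/eqP.
apply: eq_wint => t t1; have tz := subr_off_circle_neq0 t1 zT.
have t0 := unit_circle_neq0 t1; have tn0 : t ^+ n != 0 by rewrite expf_neq0.
rewrite hornerM hornerX exprS.
by move: (t ^+ n) tn0 => y y0; field; rewrite y0 tz t0.
Qed.

Lemma GE (R : realType) (nu : Cx R -> R) Phi n z :
  is_weight nu -> ~ unit_circle z ->
  G nu Phi n z = (2 * toC pi)^-1 * cauchy_transform nu n (Phi n) z.
Proof. exact: circle_integral_cauchy. Qed.

Lemma GstarE (R : realType) (nu : Cx R -> R) Phi n z :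
  is_weight nu -> ~ unit_circle z ->
  Gstar nu Phi n z =
  (2 * toC pi)^-1 * cauchy_transform nu n.+1 (rev_poly n (Phi n)) z.
Proof. exact: circle_integral_cauchy. Qed.

(** The Cauchy transform carries the recursion over to the second column; the boundary terms pair
    Phi_{n+2} with t^{n+1} and Phi_{n+1} with t^n, and both vanish. The factor z on the left comes
    from the extra power of 1/t in G_{n+2}; it is the source of the 1/z in diag(1, 1/z). *)
Lemma G_transfer (R : realType) (nu : Cx R -> R) Phi kappa n z :
  is_weight nu -> monic_OPUC nu Phi kappa -> ~ unit_circle z ->
  z * G nu Phi n.+2 z =
  (z + (alpha Phi n.+1)^* * alpha Phi n) * G nu Phi n.+1 z -
   (alpha Phi n.+1)^* / coef_b kappa n.+1 * coef_b kappa n * Gstar nu Phi n z.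
Proof.
move=> nuw hPhi zT; rewrite !GE// GstarE// mulrCA cauchy_succ//.
rewrite (OPUC_orth_Xn nuw hPhi)// subr0 {1}(OPUC_transfer n nuw hPhi).
rewrite cauchyB// cauchyD// !cauchyZ// cauchyMX// (OPUC_orth_Xn nuw hPhi)//.
by move: (_^-1) => c; ring.
Qed.

Lemma Gstar_transfer (R : realType) (nu : Cx R -> R) Phi kappa n z :
  is_weight nu -> monic_OPUC nu Phi kappa -> ~ unit_circle z ->
  z * (coef_b kappa n.+1 * Gstar nu Phi n.+1 z) =
  coef_b kappa n * Gstar nu Phi n z -
  alpha Phi n * coef_b kappa n.+1 * G nu Phi n.+1 z.
Proof.
move=> nuw hPhi zT; rewrite !GE// !GstarE//.
rewrite [LHS](_ : _ = (2 * toC pi)^-1 * (coef_b kappa n.+1 *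
    (z * cauchy_transform nu n.+2 (rev_poly n.+1 (Phi n.+1)) z))); last first.
  by move: (_^-1) => c; ring.
(* The boundary term pairs Phi_{n+1}^* with t^{n+1}, which is 1 paired with Phi_{n+1}, hence 0. *)
rewrite cauchy_succ// (ip_rev_OPUC hPhi)// subnn (OPUC_orth nuw hPhi) ?size_polyXn//.
rewrite subr0 -cauchyZ// (rev_OPUC_transfer n nuw hPhi) cauchyB// !cauchyZ//.
by move: (_^-1) => c; ring.
Qed.

(** * Two-by-two matrices, the transfer relation and the determinant of Y_n *)

Lemma mx2E (K : pzRingType) (a b c d a' b' c' d' : K) :
  mx2 a b c d *m mx2 a' b' c' d' =
  mx2 (a * a' + b * c') (a * b' + b * d') (c * a' + d * c') (c * b' + d * d').
Proof.
apply/matrixP => i j; rewrite !mxE big_ord_recl big_ord1 !mxE.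
by case: (i == 0); case: (j == 0).
Qed.

Lemma det_mx2 (K : comPzRingType) (a b c d : K) :
  \det (mx2 a b c d) = a * d - b * c.
Proof.
rewrite (expand_det_row _ 0) big_ord_recl big_ord1 /cofactor !det_mx11 !mxE /=.
by ring.
Qed.

Lemma Ymx_transfer (R : realType) (nu : Cx R -> R) Phi kappa n z :
  is_weight nu -> monic_OPUC nu Phi kappa -> (0 < n)%N -> z != 0 ->
  ~ unit_circle z ->
  Ymx nu Phi kappa n.+1 z =
  transfer_mx Phi kappa n z *m Ymx nu Phi kappa n z *m mx2 1 0 0 z^-1.
Proof.
move=> nuw hPhi; case: n => // n _ z0 zT; rewrite /Ymx /transfer_mx !mx2E /=.
have := G_transfer n nuw hPhi zT; have := Gstar_transfer n nuw hPhi zT.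
move=> /(canRL (mulKf z0)) hs /(canRL (mulKf z0)) hG.
congr mx2; rewrite !(mul1r, mulr1, mulr0, add0r, addr0).
- by rewrite {1}(OPUC_transfer n nuw hPhi) !hornerE /=; ring.
- by rewrite hG; ring.
- by rewrite mulNr -hornerZ (rev_OPUC_transfer n nuw hPhi) !hornerE /=; ring.
- by rewrite mulNr hs; ring.
Qed.

(** det T_n = z cancels det diag(1, 1/z), so the determinant does not depend on n and is evaluated
    at n = 1. *)
Lemma det_Ymx (R : realType) (nu : Cx R -> R) Phi kappa n z :
  is_weight nu -> monic_OPUC nu Phi kappa -> (0 < n)%N -> z != 0 ->
  ~ unit_circle z -> \det (Ymx nu Phi kappa n z) = 1.
Proof.
move=> nuw hPhi n0 z0 zT; case: n n0 => // + _; elim => [|n ih].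
  have P0 : Phi 0 = 1.
    have [/monicP + sP] := OPUC_monic 0 hPhi.
    have /size_poly1P [c _ ->] : size (Phi 0) == 1 by rewrite sP.
    by rewrite lead_coefC => ->.
  have r0 : rev_poly 0 (Phi 0) = 1.
    by apply/polyP => -[|k]; rewrite P0 coef_poly !coefE /= ?conjC1.
  have h0 := ip_OPUC 0 0 hPhi; rewrite eqxx mulr1 P0 in h0.
  have k0 := kappaV_neq0 0 hPhi.
  rewrite det_mx2 /= GE// GstarE// r0 (Szego_recursion 0 nuw hPhi) r0 P0.
  rewrite cauchyB// cauchyMX// cauchyZ// !hornerE expr0 h0 coef_bE.
  have -> : toC (pi *+ 2) = 2 * toC pi :> Cx R by rewrite /toC rmorphMn mulr_natl.
  have : 2 * toC pi != 0 :> Cx R.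
    by rewrite mulf_neq0 ?pnatr_eq0// fmorph_eq0 gt_eqF// pi_gt0.
  move: (toC (_ ^- 2)) (2 * _) k0 => k c k0 c0 /=.
  by field; rewrite c0 k0.
rewrite (Ymx_transfer nuw hPhi)// !det_mulmx ih !det_mx2.
have b0 := coef_b_neq0 n.+1 hPhi; move: (coef_b _ _) b0 => b b0.
by field; rewrite b0 z0.
Qed.

(** * Structure matrices *)

(** Unlike [mx_derive], which always has some value, this relation also records that the entries are
    differentiable. *)
Definition is_mx_derive (R : realType) (z : Cx R) (F : Cx R -> 'M[Cx R]_2)
    (F' : 'M[Cx R]_2) : Prop :=
  forall i j, is_derive z 1 (fun w => F w i j) (F' i j).

Lemma is_mx_deriveE (R : realType) (z : Cx R) (F : Cx R -> 'M[Cx R]_2) F' :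
  is_mx_derive z F F' -> mx_derive F z = F'.
Proof.
move=> FF'; apply/matrixP => i j; rewrite mxE derive1E.
exact: (@derive_val _ _ _ _ _ _ _ (FF' i j)).
Qed.

Lemma is_mx_derive_near (R : realType) (z : Cx R) (F H : Cx R -> 'M[Cx R]_2) F' :
  (\forall w \near z, F w = H w) -> is_mx_derive z F F' -> is_mx_derive z H F'.
Proof.
move=> FH FF' i j; apply: near_eq_is_derive (FF' i j).
by apply: filterS FH => w ->.
Qed.

Lemma is_derive_mul (R : realType) (z : Cx R) (f g : Cx R -> Cx R) df dg :
  is_derive z 1 f df -> is_derive z 1 g dg ->
  is_derive z 1 (fun w => f w * g w) (df * g z + f z * dg).
Proof.
move=> fd gd; apply: (is_derive_eq (is_deriveM fd gd)).
by rewrite /GRing.scale /= addrC mulrC.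
Qed.

Lemma is_derive_const (R : realType) (z c : Cx R) :
  is_derive z 1 (fun=> c) (0 : Cx R).
Proof. exact: (is_derive_cst c z 1). Qed.

Lemma is_derive_cmul (R : realType) (z c : Cx R) (f : Cx R -> Cx R) df :
  is_derive z 1 f df -> is_derive z 1 (fun w => c * f w) (c * df).
Proof.
move=> fd; apply: (is_derive_eq (is_derive_mul (is_derive_const z c) fd)).
by rewrite mul0r add0r.
Qed.

Lemma is_derive_horner (R : realType) (p : {poly Cx R}) (z : Cx R) :
  is_derive z 1 (horner p) p^`().[z].
Proof.
elim/poly_ind: p => [|p c ih].
  rewrite deriv0 horner0 (_ : horner 0 = cst 0); first exact: is_derive_const.
  by apply/funext => w; rewrite horner0.
rewrite (_ : horner _ = (fun w => p.[w] * w) + cst c); last first.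
  by apply/funext => w; rewrite hornerMXaddC.
apply: (is_derive_eq (is_deriveD (is_derive_mul ih (is_derive_id _ _))
  (is_derive_cst c _ _))).
by rewrite derivMXaddC hornerD hornerMX mulr1 addr0 addrC.
Qed.

Lemma is_mx_deriveM (R : realType) (z : Cx R) (F H : Cx R -> 'M[Cx R]_2) F' H' :
  is_mx_derive z F F' -> is_mx_derive z H H' ->
  is_mx_derive z (fun w => F w *m H w) (F' *m H z + F z *m H').
Proof.
move=> FF' HH' i j.
rewrite (_ : (fun w => _) = (fun w => F w i 0 * H w 0 j) +
    (fun w => F w i 1 * H w 1 j)); last first.
  apply/funext => w; rewrite !mxE big_ord_recl big_ord1.
  by congr (_ + F w i _ * H w _ j); apply/val_inj.
apply: (is_derive_eq (is_deriveD (is_derive_mul (FF' i 0) (HH' 0 j))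
  (is_derive_mul (FF' i 1) (HH' 1 j)))).
rewrite !mxE !big_ord_recl !big_ord0 !addr0.
rewrite (_ : lift ord0 ord0 = 1 :> 'I_2); last exact/val_inj.
by rewrite -[ord0]/(0 : 'I_2) addrACA.
Qed.

Lemma is_mx_derive_mx2 (R : realType) (z : Cx R) (a b c d : Cx R -> Cx R)
    a' b' c' d' :
  is_derive z 1 a a' -> is_derive z 1 b b' ->
  is_derive z 1 c c' -> is_derive z 1 d d' ->
  is_mx_derive z (fun w => mx2 (a w) (b w) (c w) (d w)) (mx2 a' b' c' d').
Proof.
move=> ha hb hc hd i j; rewrite mxE.
rewrite (_ : (fun w => _) = if i == ord0 then (if j == ord0 then a else b)
    else (if j == ord0 then c else d)).
  by case: (i == _); case: (j == _).
by apply/funext => w; rewrite mxE; case: (i == _); case: (j == _).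
Qed.

Lemma is_derive_inv (R : realType) (z : Cx R) (f : Cx R -> Cx R) df :
  f z != 0 -> is_derive z 1 f df ->
  is_derive z 1 (fun w => (f w)^-1) (- (f z ^- 2 * df)).
Proof.
move=> f0 fd; have fz : derivable f z 1 by case: fd.
apply: (is_derive_eq (derivableP (derivableV f0 fz))).
by rewrite deriveV// (@derive_val _ _ _ _ _ _ _ fd) /GRing.scale /= mulNr.
Qed.

(** The value of the derivative is left abstract because it is eliminated between the relations at n
    and n+1. G and G^* are identified with Cauchy transforms off the circle, hence the passage
    through a neighbourhood of [z]. *)
Lemma is_mx_derive_Ymx (R : realType) (nu : Cx R -> R) Phi (kappa : nat -> R) n z :
  is_weight nu -> ~ unit_circle z ->
  exists Y', is_mx_derive z (Ymx nu Phi kappa n) Y'.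
Proof.
move=> nuw zT.
have cd m (p : {poly Cx R}) : exists l, is_derive z 1
   (fun w => (2 * toC pi)^-1 * cauchy_transform nu m p w) l.
  eexists; apply: is_derive_cmul.
  by apply: is_derive_Cauchy => //; exact: circle_continuous_cauchy_density.
have [g hg] := cd n (Phi n).
have [gs hgs] := cd n.-1.+1 (rev_poly n.-1 (Phi n.-1)).
eexists; apply: is_mx_derive_mx2.
- exact: is_derive_horner.
- apply: near_eq_is_derive hg; apply: filterS (near_off_circle zT) => w wT.
  by rewrite GE.
- by apply: is_derive_cmul; exact: is_derive_horner.
- apply: is_derive_cmul; apply: near_eq_is_derive hgs.
  apply: filterS (near_off_circle zT) => w wT.
  by rewrite GstarE.
Qed.

(** * Logarithmic derivatives of powers, square roots and branches *)

Lemma is_derive_exprn (R : realType) (z : Cx R) (f : Cx R -> Cx R) a n :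
  is_derive z 1 f (a * f z) ->
  is_derive z 1 (fun w => f w ^+ n) (n%:R * a * f z ^+ n).
Proof.
move=> fd; elim: n => [|n ih].
  by rewrite !mul0r; under eq_fun do rewrite expr0; exact: is_derive_const.
under eq_fun do rewrite exprS.
apply: (is_derive_eq (is_derive_mul fd ih)).
by rewrite exprS -natr1; ring.
Qed.

(** Differentiating g^2 = f gives 2 g g' = a g^2, and g does not vanish where its square does
    not. *)
Lemma is_derive_sqrt (R : realType) (z : Cx R) (f g : Cx R -> Cx R) a :
  f z != 0 -> is_derive z 1 f (a * f z) -> sqrt_branch f z g ->
  g z != 0 /\ is_derive z 1 g (a / 2 * g z).
Proof.
move=> f0 fd gs; have [gd gz] := nbhs_singleton gs.
have g0 : g z != 0 by move: f0; rewrite -gz expf_eq0.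
have gd' := derivableP gd.
have : is_derive z 1 f ('D_1 g z * g z + g z * 'D_1 g z).
  apply: near_eq_is_derive; last exact: (is_derive_mul gd' gd').
  by apply: filterS gs => w [_ <-]; rewrite expr2.
move=> /(@derive_val _ _ _ _ _ _ _); rewrite (@derive_val _ _ _ _ _ _ _ fd) -gz => e.
split => //; apply: (is_derive_eq gd').
apply: (mulIf g0); apply: (@mulfI _ 2); first by rewrite pnatr_eq0.
rewrite [LHS](_ : _ = 'D_1 g z * g z + g z * 'D_1 g z); last by ring.
by rewrite -e; field.
Qed.

(** Near [z] the branch is the last function element [F 1], which satisfies the differential
    equation; its logarithmic derivative q / (z A) is the same for every branch. *)
Lemma is_derive_nu_branch (R : realType) (nu : Cx R -> R) (A : {poly Cx R}) q z f :
  nu_branch nu A q z f -> ~ Z_ A z ->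
  f z != 0 /\ is_derive z 1 f (q z / (z * A.[z]) * f z).
Proof.
move=> [gamma [F [[_ _ _ g1] HF _ _ fF]]] /eqP zA.
have /HF : (1 : R) \in `[0, 1] by rewrite in_itv /= ler01 lexx.
rewrite g1 => /nbhs_singleton [Fd F0 Fe].
have fz : f z = F 1 z := nbhs_singleton fF.
rewrite fz; split; first exact: F0.
have Ff : \forall w \near z, F 1 w = f w by apply: filterS fF => w ->.
apply: (near_eq_is_derive Ff).
apply: (is_derive_eq (derivableP Fd)).
apply: (mulfI zA); rewrite -derive1E Fe.
by move: zA; rewrite mulf_eq0 negb_or => /andP[z0 A0]; field; rewrite z0 A0.
Qed.

(* C_n' = a_n diag(1, -1) C_n for the scalar a_n = log_rate A q n. *)
Definition log_rate (R : realType) (A : {poly Cx R}) (q : Cx R -> Cx R) (n : nat)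
    (z : Cx R) : Cx R :=
  q z / (2 * (z * A.[z])) - n%:R / (2 * z).

(** Only the logarithmic derivatives 1/(2z) of [s] and q/(2zA) of [h] enter, so the rate is
    independent of the branches. *)
Lemma is_mx_derive_Cmx (R : realType) (nu : Cx R -> R) (A : {poly Cx R}) q
    (n : nat) (z : Cx R) s f h :
  ~ Z_ A z -> sqrt_branch id z s -> nu_branch nu A q z f -> sqrt_branch f z h ->
  \det (Cmx s h n z) = 1 /\
  is_mx_derive z (Cmx s h n)
    (mx2 (log_rate A q n z) 0 0 (- log_rate A q n z) *m Cmx s h n z).
Proof.
move=> zA ss nf sh; have zA0 : z * A.[z] != 0 by apply/eqP.
have [z0 A0] : z != 0 /\ A.[z] != 0.
  by move: zA0; rewrite mulf_eq0 negb_or => /andP[].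
have [f0 fd] := is_derive_nu_branch nf zA.
have [h0 hd] := is_derive_sqrt f0 fd sh.
have [s0 sd] : s z != 0 /\ is_derive z 1 s (z^-1 / 2 * s z).
  apply: (is_derive_sqrt (f := id)) => //.
  by rewrite mulVf//; exact: is_derive_id.
have sn0 : s z ^+ n != 0 by rewrite expf_neq0.
split; first by rewrite det_mx2; field; rewrite sn0 h0.
rewrite mx2E !(mul0r, mulr0, addr0, add0r).
have snd := is_derive_exprn n sd.
apply: (is_mx_derive_mx2 _ (is_derive_const z 0) (is_derive_const z 0)).
- have sVd := @is_derive_inv _ z (fun w => s w ^+ n) _ sn0 snd.
  apply: (is_derive_eq (is_derive_mul sVd hd)).
  rewrite /log_rate; move: (s z ^+ n) sn0 => x x0.
  by field; rewrite x0 z0 A0.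
- apply: (is_derive_eq (is_derive_mul snd (is_derive_inv h0 hd))).
  rewrite /log_rate; move: (s z ^+ n) sn0 => x x0.
  by field; rewrite h0 z0 A0.
Qed.

Lemma mx2D (K : nmodType) (a b c d a' b' c' d' : K) :
  mx2 a b c d + mx2 a' b' c' d' = mx2 (a + a') (b + b') (c + c') (d + d').
Proof.
by apply/matrixP => i j; rewrite !mxE; case: (i == _); case: (j == _).
Qed.

Lemma scalar_mx2 (K : pzRingType) (c : K) : c%:M = mx2 c 0 0 c.
Proof. by apply/matrixP => -[[|[|]]//= ?] [[|[|]]//= ?]; rewrite !mxE. Qed.

(** With S = diag(a_n, -a_n) and C' = S C, the product rule gives Z' = (Y' + Y S) C; since M Y C =
    Z', the invertible C cancels. No branch remains in the conclusion, so relations for different n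
    can be combined. *)
Lemma structure_mxE (R : realType) (nu : Cx R -> R) (A : {poly Cx R}) q Phi kappa
    n z M Y' :
  is_weight nu -> monic_OPUC nu Phi kappa -> (0 < n)%N ->
  ~ unit_circle z -> ~ Z_ A z -> is_structure_mx nu A q Phi kappa n z M ->
  is_mx_derive z (Ymx nu Phi kappa n) Y' ->
  M *m Ymx nu Phi kappa n z =
  Y' + Ymx nu Phi kappa n z *m mx2 (log_rate A q n z) 0 0 (- log_rate A q n z).
Proof.
move=> nuw hPhi n0 zT zA [s [f [h [ss nf sh ->]]]] YY'.
have z0 : z != 0 by apply: contra_not_neq zA => ->; rewrite /Z_ /= mul0r.
have [C1 CC'] := is_mx_derive_Cmx n zA ss nf sh.
rewrite (is_mx_deriveE (is_mx_deriveM YY' CC')) mulmxA -mulmxDl.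
have CU : Cmx s h n z \in unitmx by rewrite unitmxE C1 unitr1.
have ZU : Zmx nu Phi kappa s h n z \in unitmx.
  by rewrite unitmxE det_mulmx C1 (det_Ymx nuw hPhi)// mulr1 unitr1.
apply: (can_inj (mulmxK CU)); rewrite -[LHS]mulmxA.
exact: (mulmxKV ZU).
Qed.

Theorem proposition3p6 (R : realType) (nu : Cx R -> R)
    (A : {poly Cx R}) (q : Cx R -> Cx R)
    (Phi : nat -> {poly Cx R}) (kappa : nat -> R)
    (hnu : generalized_semiclassical nu A q)
    (hPhi : monic_OPUC nu Phi kappa)
    (n : nat) (hn : (0 < n)%N)
    (z : Cx R) (hzT : ~ unit_circle z) (hzA : ~ Z_ A z)
    (Mn Mn1 : 'M[Cx R]_2)
    (hMn : is_structure_mx nu A q Phi kappa n z Mn)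
    (hMn1 : is_structure_mx nu A q Phi kappa n.+1 z Mn1) :
  let T := transfer_mx Phi kappa n in
  let D := mx_derive T z - (2 * z)^-1 *: T z in
  Mn1 *m D + D *m Mn = Mn1 *m Mn1 *m T z - T z *m (Mn *m Mn).
Proof.
move=> T D; case: hnu => nuw _ _ _.
suff DE : D = Mn1 *m T z - T z *m Mn.
  move: D (T z) DE => D' T' ->.
  by rewrite mulmxBr mulmxBl !mulmxA addrA subrK.
have z0 : z != 0 by apply: contra_not_neq hzA => ->; rewrite /Z_ /= mul0r.
have [Y' YY'] := is_mx_derive_Ymx Phi kappa n nuw hzT.
pose E (w : Cx R) := mx2 1 0 0 w^-1.
pose E' : 'M[Cx R]_2 := mx2 0 0 0 (- z ^- 2).
have EE' : is_mx_derive z E E'.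
  apply: is_mx_derive_mx2; [exact: is_derive_const..|].
  apply: (is_derive_eq (is_derive_inv z0 (is_derive_id _ _))).
  by rewrite mulr1.
have TT' : is_mx_derive z T (mx_derive T z).
  suff [T' TT'] : exists T', is_mx_derive z T T' by rewrite (is_mx_deriveE TT').
  exists (mx2 (1 + 0) 0 0 0); apply: (is_mx_derive_mx2
    (is_deriveD (is_derive_id z 1) (is_derive_const z _))
    (is_derive_const z _) (is_derive_const z _) (is_derive_const z _)).
pose Y := Ymx nu Phi kappa n.
have YS w : w != 0 -> ~ unit_circle w ->
    T w *m Y w *m E w = Ymx nu Phi kappa n.+1 w.
  by move=> w0 wT; rewrite (Ymx_transfer nuw hPhi).
have Y1Y1' : is_mx_derive z (Ymx nu Phi kappa n.+1)
    ((mx_derive T z *m Y z + T z *m Y') *m E z + T z *m Y z *m E').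
  apply: is_mx_derive_near (is_mx_deriveM (is_mx_deriveM TT' YY') EE').
  near=> w; apply: YS; last by near: w; exact: near_off_circle.
  (* The ball of radius |z| around z leaves out 0. *)
  near: w; apply/nbhs_ballP; exists `|z| => [|w /=]; first by rewrite /= normr_gt0.
  by apply: contraTneq => ->; rewrite /ball /= subr0 ltxx.
have := structure_mxE nuw hPhi (ltn0Sn n) hzT hzA hMn1 Y1Y1'.
have := structure_mxE nuw hPhi hn hzT hzA hMn YY'.
rewrite -YS// -/(Y z) => HM.
set S1 := mx2 (log_rate A q n.+1 z) _ _ _; set S0 := mx2 _ _ _ _ in HM.
move=> HM1.
(* This is where -1/(2z) arises. The upper entry says a_{n+1} = a_n - 1/(2z); in the lower one the
   derivative of 1/z contributes a further -1/z, turning -a_n + 1/(2z) into -a_n - 1/(2z), so both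
   corrections are the same scalar and commute with everything. *)
have ES : E' + E z *m S1 = (S0 + (- (2 * z)^-1)%:M) *m E z.
  rewrite scalar_mx2 /S0 /S1 /E /E' mx2D !mx2E mx2D.
  have zA0 : z * A.[z] != 0 by apply/eqP.
  have [_ A0] : z != 0 /\ A.[z] != 0.
    by move: zA0; rewrite mulf_eq0 negb_or => /andP[].
  rewrite /log_rate -natr1.
  by congr mx2; field; rewrite ?z0 ?A0.
have YEU : Y z *m E z \in unitmx.
  rewrite unitmx_mul !unitmxE (det_Ymx nuw hPhi)// det_mx2 unitr1 /=.
  by rewrite mul1r mul0r subr0 unitfE invr_eq0.
(* After cancelling Y E on the right, Y' occurs only in T (Y' + Y S0), which the relation at n turns
   into T M_n Y. *)
suff H : Mn1 *m T z = D + T z *m Mn by rewrite H addrK.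
apply: (can_inj (mulmxK YEU)).
rewrite -(mulmxA Mn1) (mulmxA (T z) (Y z)) HM1 -addrA.
rewrite -(mulmxA (T z *m Y z)) -mulmxDr ES.
rewrite mulmxA -mulmxDl [RHS]mulmxA; congr (_ *m _).
rewrite mulmxDr mul_mx_scalar !mulmxDl mulNmx -scalemxAl -(mulmxA _ Mn) HM.
rewrite mulmxDr !mulmxA scaleNr -!addrA; congr (_ + _).
by rewrite addrA [RHS]addrC.
Unshelve. all: by end_near.
Qed.
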